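(* Let $d$ and $t$ be positive integers and let $\pi_y$ be a $t$-design POVM on a $d$-dimensional complex Hilbert space. Let $\eta(x) := -x\ln x$. Let $0 < x_1 < x_2 < \dots < x_{\lfloor t/2\rfloor} < 1$ be real numbers (no numbers if $t=1$), and let $p(x) := \sum_{k=1}^t a_k x^k$ be the real polynomial such that $p(1) = 0$ if $t$ is odd, and $p^{(j)}(x_i) = \eta^{(j)}(x_i)$ for all $1 \le i \le \lfloor t/2\rfloor$ and $j = 0,1$ (where $^{(j)}$ denotes the $j$-th derivative). Then the informational power of $\pi_y$ satisfies $$W(\pi_y) \le \ln d - d\sum_{k=1}^t a_k \binom{d+k-1}{k}^{-1}.$$
   Context: Let $\mathcal{H}$ be a $d$-dimensional complex Hilbert space. A state is a positive semidefinite operator $\rho$ on $\mathcal{H}$ with $\operatorname{Tr}[\rho]\le 1$; an effect is a positive semidefinite operator $\pi \le \mathbb{1}_d$. An ensemble is a measurable function $x\mapsto\rho_x$ from the reals to states with $\int \operatorname{Tr}[\rho_x]\,dx = 1$. A POVM is a measurable function $y\mapsto\pi_y$ from the reals to effects with $\int \pi_y\,dy = \mathbb{1}_d$. Finite ensembles and finite POVMs are included (sums in place of integrals, or equivalently step functions). A POVM $\pi_y$ is a $t$-design POVM if the ensemble $\pi_y/d$ is a spherical quantum $t$-design, i.e. for every integer $1\le k\le t$, $\int \frac{\pi_y^{\otimes k}}{\operatorname{Tr}[\pi_y]^{k-1}}\,dy = d\binom{d-1+k}{k}^{-1} P_{\mathrm{sym}}$, where $P_{\mathrm{sym}}$ is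 the orthogonal projector onto the symmetric subspace of $\mathcal{H}^{\otimes k}$ (the right-hand side is $d$ times the corresponding average over pure states distributed with the uniform (Haar) measure on the unit sphere); the integrand is $0$ where $\pi_y=0$. For an ensemble $\rho_x$ and a POVM $\pi_y$, let $p_{x,y}=\operatorname{Tr}[\rho_x\pi_y]$ with marginals $p_x,p_y$; the mutual information is $I(\rho_x,\pi_y) := \iint p_{x,y}\ln\frac{p_{x,y}}{p_xp_y}\,dx\,dy$ (with $0\ln 0=0$). The informational power is $W(\pi_y) := \sup_{\rho_x} I(\rho_x,\pi_y)$, the supremum being over all ensembles. *)

(* Defs.v *)
From HB Require Import structures.
From mathcomp Require Import all_boot all_order all_fingroup all_algebra.
From mathcomp Require Import sesquilinear spectral.
From mathcomp Require Import complex.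
From mathcomp Require Import all_classical all_reals all_analysis.

Set Implicit Arguments.
Unset Strict Implicit.
Unset Printing Implicit Defensive.

Import Order.TTheory GRing.Theory Num.Theory.
Import numFieldNormedType.Exports.

Local Open Scope classical_set_scope.
Local Open Scope ring_scope.
Local Open Scope complex_scope.
Local Open Scope sesquilinear_scope.

(* The d-dimensional Hilbert space is C^d, with
   C = R[i] for R : realType, and operators on it are 'M[R[i]]_d. *)

Definition psd (R : realType) (d : nat) (A : 'M[R[i]]_d) : Prop :=
  A \is hermsymmx /\ forall v : 'cV[R[i]]_d, 0 <= (v ^t* *m A *m v) 0 0.

Definition is_state (R : realType) (d : nat) (rho : 'M[R[i]]_d) : Prop :=
  psd rho /\ \tr rho <= 1.

Definition is_effect (R : realType) (d : nat) (E : 'M[R[i]]_d) : Prop :=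
  psd E /\ psd (1%:M - E).

(* Measurability and Lebesgue integration over the real line of matrix-valued
   functions are entrywise, through real and imaginary parts. *)

Definition mx_measurable (R : realType) (d : nat)
    (F : R -> 'M[R[i]]_d) : Prop :=
  forall i j,
    measurable_fun setT (fun x : measurableTypeR R => complex.Re (F x i j)) /\
    measurable_fun setT (fun x : measurableTypeR R => complex.Im (F x i j)).

Definition mx_integrable (R : realType) (d : nat)
    (F : R -> 'M[R[i]]_d) : Prop :=
  forall i j,
    (@lebesgue_measure R).-integrable setT
      (fun x => (complex.Re (F x i j))%:E) /\
    (@lebesgue_measure R).-integrable setT
      (fun x => (complex.Im (F x i j))%:E).

Definition mx_integral (R : realType) (d : nat)
    (F : R -> 'M[R[i]]_d) : 'M[R[i]]_d :=
  \matrix_(i, j)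
    ((\int[@lebesgue_measure R]_x complex.Re (F x i j)) +i*
     (\int[@lebesgue_measure R]_x complex.Im (F x i j))).

Definition has_mx_integral (R : realType) (d : nat)
    (F : R -> 'M[R[i]]_d) (M : 'M[R[i]]_d) : Prop :=
  mx_integrable F /\ mx_integral F = M.

(* Finite ensembles and finite POVMs are the step functions that are constant
   on finitely many disjoint intervals of length 1 and vanish elsewhere. *)

Definition is_ensemble (R : realType) (d : nat)
    (rho : R -> 'M[R[i]]_d) : Prop :=
  [/\ mx_measurable rho,
      forall x, is_state (rho x) &
      (\int[@lebesgue_measure R]_x (complex.Re (\tr (rho x)))%:E = 1)%E].

Definition is_povm (R : realType) (d : nat) (E : R -> 'M[R[i]]_d) : Prop :=
  [/\ mx_measurable E,
      forall y, is_effect (E y) &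
      has_mx_integral E 1%:M].

Definition tens_dim (d k : nat) : nat := #|{ffun 'I_k -> 'I_d}|.

(* The standard basis of (C^d)^{(x) k} is indexed by the maps 'I_k -> 'I_d. *)
Definition tens_index (d k : nat) (i : 'I_(tens_dim d k))
    : {ffun 'I_k -> 'I_d} := enum_val i.

Definition tens_power (R : realType) (d k : nat) (A : 'M[R[i]]_d)
    : 'M[R[i]]_(tens_dim d k) :=
  \matrix_(i, j) \prod_(l < k) A (tens_index i l) (tens_index j l).

Definition tens_perm (R : realType) (d k : nat) (s : 'S_k)
    : 'M[R[i]]_(tens_dim d k) :=
  \matrix_(i, j) (tens_index j == [ffun l => tens_index i (s l)])%:R.

(* Row space = the (row) vectors of (C^d)^{(x) k} fixed by every permutation of
   the k tensor factors. *)
Definition sym_space (R : realType) (d k : nat)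
    : 'M[R[i]]_(tens_dim d k) :=
  (\bigcap_(s : 'S_k) kermx (tens_perm R d s - 1%:M))%MS.

(* proj_ortho acts on row vectors by right multiplication.  The symmetric
   subspace is stable under complex conjugation, so this matrix is symmetric and
   is also the projector when acting on column vectors by left
   multiplication. *)
Definition sym_proj (R : realType) (d k : nat)
    : 'M[R[i]]_(tens_dim d k) :=
  proj_ortho (sym_space R d k).

(* Since x^-1 = 0 at x = 0, and tens_power k 0 = 0 for k > 0, the integrand is 0
   wherever E y = 0. *)
Definition is_design_povm (R : realType) (d t : nat)
    (E : R -> 'M[R[i]]_d) : Prop :=
  is_povm E /\
  forall k : nat, (1 <= k <= t)%N ->
    has_mx_integral
      (fun y => ((\tr (E y)) ^+ (k - 1))^-1 *: tens_power k (E y))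
      ((d%:R * ('C(d - 1 + k, k)%:R)^-1) *: sym_proj R d k).

(* The trace of a product of two positive semidefinite matrices is real. *)
Definition joint (R : realType) (d : nat) (rho E : R -> 'M[R[i]]_d)
    (x y : R) : R :=
  complex.Re (\tr (rho x *m E y)).

Definition marginal_x (R : realType) (d : nat) (rho E : R -> 'M[R[i]]_d)
    (x : R) : R :=
  \int[@lebesgue_measure R]_y joint rho E x y.

Definition marginal_y (R : realType) (d : nat) (rho E : R -> 'M[R[i]]_d)
    (y : R) : R :=
  \int[@lebesgue_measure R]_x joint rho E x y.

(* The double integral is against the product Lebesgue measure and may be +oo.
   By the conventions r / 0 = 0 and ln 0 = 0, the integrand is 0 wherever the
   joint density or a marginal vanishes. *)
Definition mutual_information (R : realType) (d : nat)
    (rho E : R -> 'M[R[i]]_d) : \bar R :=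
  (\int[@lebesgue_measure R \x @lebesgue_measure R]_z
    (joint rho E z.1 z.2 *
     ln (joint rho E z.1 z.2 /
         (marginal_x rho E z.1 * marginal_y rho E z.2)))%:E)%E.

Definition informational_power (R : realType) (d : nat)
    (E : R -> 'M[R[i]]_d) : \bar R :=
  ereal_sup [set mutual_information rho E | rho in @is_ensemble R d].

Definition eta_fn (R : realType) (x : R) : R := - x * ln x.

(* Main.v *)
Require Import Defs.
From HB Require Import structures.
From mathcomp Require Import all_boot all_order all_fingroup all_algebra.
From mathcomp Require Import sesquilinear spectral.
From mathcomp Require Import complex.
From mathcomp Require Import all_classical all_reals all_analysis.
From mathcomp Require Import measurable_realfun ring lra.

Set Implicit Arguments.
Unset Strict Implicit.
Unset Printing Implicit Defensive.

Import Order.TTheory GRing.Theory Num.Theory.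
Import numFieldNormedType.Exports.

Local Open Scope ring_scope.
Local Open Scope complex_scope.
Local Open Scope sesquilinear_scope.

(* Comparing the output density p_y with Tr[pi_y] / d (Gibbs' inequality) gives
     I <= ln d - \int p_x (\int Tr[pi_y] eta(u_xy) dy) dx,
   with u_xy = Tr[rho_x pi_y] / (Tr[rho_x] Tr[pi_y]) in [0, 1].  By concavity
   of eta the inner integral may be bounded below for pure states only, where
   eta >= p on [0, 1] (Hermite interpolation at x_i, at 0, and at 1 if t is odd)
   and the design property turns the integral of Tr[pi_y] u^k into
   d / 'C(d + k - 1, k). *)

(** * Hermite interpolation of eta *)

(** Since [p] has no constant term, dividing by the argument removes the node [0], where [eta] is
    not differentiable. The derivative of [ln + Q] times its argument is a polynomial, so one use of
    Rolle and a count of roots replace the sign of the derivative of order [t + 1] in the usual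
    remainder. Interior nodes are double, so the nodal polynomial keeps its sign on the interval,
    and with it the error. Pure states are singled out because their tensor powers lie in the
    symmetric subspace, where the projector has expectation one whatever the state; a mixed state
    leaves that subspace. For outcomes on the real line the output entropies need not be finite, so
    the information is never split into a difference of entropies: its integrand is bounded almost
    everywhere by an integrable function whose integral is already at most the bound. The density
    [Tr[pi_y] / d] has mass one because the POVM integrates to the identity, and its normalisation
    is the source of [ln d]. *)

(** Rolle between consecutive zeros: multiplied by [y > 0], the derivative [1/y + Q'(y)] becomes a
    polynomial, whose roots the degree bounds. The new roots avoid [a :: s] so that double nodes,
    themselves roots, can be adjoined without repetition. *)
Lemma ln_poly_rolle (R : realType) (Q : {poly R}) (a : R) (s : seq R) :
  0 < a -> path <%R a s -> {in a :: s, forall y, ln y + Q.[y] = 0} ->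
  exists ys, [/\ size ys = size s, uniq ys, all (root (1 + 'X * Q^`())) ys,
    all (> a) ys & {in ys, forall y, y \notin a :: s}].
Proof.
elim: s a => [|b s IH] a a0; first by exists [::]; split.
move=> /andP[ab pbs] zero.
have b0 := lt_trans a0 ab.
have [|ys [sys uys rys gys dys]] := IH b b0 pbs.
  by move=> y ybs; apply: zero; rewrite inE ybs orbT.
have dF (z : R) : 0 < z ->
    is_derive z 1 (fun y => ln y + Q.[y]) (z^-1 + Q^`().[z]).
  by move=> z0; apply: is_deriveD; exact: is_derive1_ln.
have dab (z : R) : z \in `]a, b[%R -> derivable (fun y => ln y + Q.[y]) z 1.
  by rewrite in_itv/= => /andP[az _]; have [] := dF z (lt_trans a0 az).
have [||c cab dc] := Rolle ab dab.
- apply: derivable_within_continuous => z; rewrite in_itv/= => /andP[az _].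
  by have [] := dF z (lt_le_trans a0 az).
- by rewrite !zero// !inE eqxx ?orbT.
move: cab; rewrite in_itv/= => /andP[ac cb].
have c0 := lt_trans a0 ac.
exists (c :: ys); split => /=.
- by rewrite sys.
- rewrite uys andbT; apply/negP => /(allP gys); lra.
- rewrite rys andbT rootE !hornerE.
  have h : c^-1 + Q^`().[c] = 0.
    rewrite -(@derive_val _ _ _ _ _ _ _ (dF c c0)).
    by rewrite (@derive_val _ _ _ _ _ _ _ dc).
  have -> : 1 + c * Q^`().[c] = c * (c^-1 + Q^`().[c]).
    by rewrite mulrDr divff ?gt_eqF.
  by rewrite h mulr0.
- rewrite ac; apply/allP => y /(allP gys); exact: lt_trans.
- move=> y; rewrite inE => /predU1P[->|yys].
    rewrite !inE gt_eqF// lt_eqF//=.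
    have /allP bs := order_path_min lt_trans pbs.
    by apply/negP => /bs; lra.
  rewrite inE (negPf (dys _ yys)) orbF gt_eqF//.
  by apply: lt_trans ab _; exact: (allP gys).
Qed.

(* Subtracting the multiple c W of the nodal polynomial that makes
   ln + q - c W vanish at u creates one more zero; the polynomial
   1 + X (q - c W)' = X (ln + q - c W)' then has exactly t positive roots and
   the value 1 at 0, which gives the sign of its leading coefficient - t c. *)
Lemma ln_hermite_le (R : realType) (b : bool) (xs : seq R) (q : {poly R})
    (u : R) :
  (0 < size xs + size xs + b)%N ->
  (size q <= size xs + size xs + b)%N -> uniq xs ->
  {in xs, forall z : R, 0 < z < 1} ->
  {in xs, forall z, ln z + q.[z] = 0 /\ root (1 + 'X * q^`()) z} ->
  (b -> q.[1] = 0) -> 0 < u <= 1 -> ln u + q.[u] <= 0.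
Proof.
move=> t0 sq uxs xs01 qxs qb /andP[u0 u1].
have [/qxs[-> _]//|uxs'] := boolP (u \in xs).
have [/andP[/eqP -> /qb ->]|ub1] := boolP ((u == 1) && b).
  by rewrite ln1 addr0.
(* Nodes with multiplicity: two for each point of [xs], and a simple one at [1] exactly when [b]. *)
set rs := xs ++ xs ++ nseq b 1.
have srs : size rs = (size xs + size xs + b)%N.
  by rewrite !size_cat size_nseq addnA.
set t := (_ + _ + _)%N in t0 sq srs.
set W := \prod_(z <- rs) ('X - z%:P).
have Wb : b -> W.[1] = 0.
  move=> bT; apply/eqP; rewrite -rootE root_prod_XsubC !mem_cat mem_nseq.
  by rewrite bT eqxx !orbT.
have Wxs z : z \in xs -> W.[z] = 0 /\ (W^`()).[z] = 0.
  move=> zxs.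
  have [V WV] : exists V, W = ('X - z%:P) ^+ 2 * V.
    rewrite /W /rs !big_cat/= mulrA -expr2.
    rewrite (big_rem z)//= exprMn -mulrA; by eexists.
  rewrite WV expr2 !derivM derivXsubC !(hornerM, hornerXsubC, hornerD, hornerC).
  by rewrite subrr; split; ring.
have Wu : W.[u] = (\prod_(z <- xs) (u - z)) ^+ 2 * (u - 1) ^+ b.
  rewrite /W horner_prod; under eq_bigr do rewrite !hornerE.
  by rewrite !big_cat/= mulrA -expr2 big_nseq iter_mulr_1.
have Wu0 : W.[u] != 0.
  rewrite Wu mulf_neq0//; last first.
    move: ub1; case: (b); rewrite ?oner_neq0// andbT => u_neq1.
    by rewrite expr1 subr_eq0.
  rewrite expf_neq0// prodf_seq_neq0; apply/allP => z zxs /=; rewrite subr_eq0.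
  by apply: contraNneq uxs' => ->.
pose c := (ln u + q.[u]) / W.[u].
pose Q := q - c *: W.
have QE z : Q.[z] = q.[z] - c * W.[z] by rewrite /Q hornerD hornerN hornerZ.
have Qu : ln u + Q.[u] = 0 by rewrite QE /c divfK// addrA subrr.
pose zs := sort <=%R (u :: xs ++ nseq b 1).
have uzs : uniq zs.
  rewrite sort_uniq /= cat_uniq uxs mem_cat (negPf uxs') mem_nseq/=.
  have -> /= : (0 < b)%N && (u == 1) = false by rewrite lt0b andbC (negPf ub1).
  case: (b) => //=; rewrite orbF andbT; apply/negP => /xs01; lra.
have zsP z : z \in zs -> 0 < z /\ ln z + Q.[z] = 0.
  rewrite mem_sort inE => /predU1P[->//|]; rewrite mem_cat => /orP[zxs|].
    have /andP[z0 _] := xs01 _ zxs; split => //.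
    by rewrite QE (Wxs _ zxs).1 mulr0 subr0 (qxs _ zxs).1.
  rewrite mem_nseq lt0b => /andP[bT /eqP->]; split=> //.
  by rewrite ln1 add0r QE qb// Wb// mulr0 subr0.
have szs : size zs = (size xs + b).+1.
  by rewrite size_sort /= size_cat size_nseq.
have : sorted <%R zs by rewrite lt_sorted_uniq_le uzs sort_le_sorted.
have : zs =i u :: xs ++ nseq b 1 := mem_sort _ _.
case: zs szs zsP {uzs} => // a s [ss] zsP mems pas.
have [a0 _] := zsP a (mem_head _ _).
have [ys [sys uys rys gys dys]] :
   exists ys, [/\ size ys = size s, uniq ys, all (root (1 + 'X * Q^`())) ys,
    all (> a) ys & {in ys, forall y, y \notin a :: s}].
  by apply: ln_poly_rolle => // y /zsP[].
set r := 1 + 'X * Q^`() in rys.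
have r0 : r.[0] = 1 by rewrite /r !hornerE.
have rneq0 : r != 0.
  by apply: contra_eq_neq r0 => ->; rewrite horner0 eq_sym oner_neq0.
(* [W] vanishes to order two on [xs], so these points stay roots of [r]; the [size xs + b] Rolle
   points complete them to [t] distinct roots, the most that the degree allows. *)
pose zz := xs ++ ys.
have szz : size zz = t by rewrite size_cat sys ss addnA.
have uzz : uniq zz.
  rewrite cat_uniq uxs uys andbT /=; apply/hasPn => y /dys.
  by rewrite mems inE mem_cat !negb_or => /and3P[].
have rzz : all (root r) zz.
  rewrite all_cat rys andbT; apply/allP => z zxs.
  have [_] := qxs _ zxs; rewrite !rootE /r /Q derivB derivZ.
  rewrite !(hornerD, hornerM, hornerN, hornerZ).
  by rewrite (Wxs _ zxs).2 mulr0 subr0.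
have pzz z : z \in zz -> 0 < z.
  rewrite mem_cat => /orP[/xs01/andP[]//|/(allP gys)]; exact: lt_trans.
have szW : size W = t.+1 by rewrite /W size_prod_XsubC srs.
have sQ : (size Q <= t.+1)%N.
  rewrite /Q (leq_trans (size_polyD _ _))// geq_max (leq_trans sq)//=.
  by rewrite size_polyN (leq_trans (size_scale_leq _ _))// szW.
have sr : size r = t.+1.
  apply/eqP; rewrite eqn_leq; apply/andP; split; last first.
    by have := max_poly_roots rneq0 rzz uzz; rewrite szz.
  rewrite /r (leq_trans (size_polyD _ _))// geq_max size_poly1 /=.
  rewrite (leq_trans (size_polyMleq _ _))// size_polyX /=.
  rewrite ltnS; have [->|Q0] := eqVneq Q 0; first by rewrite deriv0 size_poly0.
  by rewrite -ltnS (leq_trans (lt_size_deriv Q0)).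
have lr : lead_coef r = - c * t%:R.
  rewrite lead_coefE sr /= /r coefD coef1 gtn_eqF//= add0r coefXM gtn_eqF//=.
  rewrite coef_deriv prednK// /Q coefB coefZ (nth_default _ sq) sub0r.
  have -> : W`_t = 1.
    have /monicP := monic_prod_XsubC rs xpredT id.
    by rewrite lead_coefE -/W szW.
  by rewrite mulr1 mulr_natr.
have : r = lead_coef r *: \prod_(z <- zz) ('X - z%:P).
  by apply: all_roots_prod_XsubC; rewrite ?sr ?szz// uniq_rootsE.
(* At [0] the factorisation reads [1 = - c t (-1)^t \prod z]. The roots are positive and [t] has the
   parity of [b], so [c (-1)^b < 0], whereas [(-1)^b W(u) >= 0] because [u <= 1]. *)
move/(congr1 (horner^~ 0)); rewrite r0 hornerZ horner_prod lr.
under eq_bigr do rewrite hornerXsubC sub0r -mulN1r.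
rewrite big_split /= big_const_seq count_predT szz iter_mulr_1 => h.
have P0 : 0 < \prod_(z <- zz) z by rewrite big_seq prodr_gt0.
have st : (-1) ^+ t = (-1) ^+ b :> R.
  by rewrite /t addnn exprD -mul2n exprM sqrrN expr1n expr1n mul1r.
have cs : c * (-1) ^+ b < 0.
  rewrite ltNge; apply/negP => cb.
  have : - (c * (-1) ^+ b * (t%:R * \prod_(z <- zz) z)) = 1.
    by rewrite [RHS]h st; ring.
  have : 0 <= c * (-1) ^+ b * (t%:R * \prod_(z <- zz) z).
    by rewrite mulr_ge0// mulr_ge0// ltW.
  lra.
have -> : ln u + q.[u] = c * W.[u] by rewrite /c divfK.
have -> : c * W.[u] =
    c * (-1) ^+ b * ((\prod_(z <- xs) (u - z)) ^+ 2 * (1 - u) ^+ b).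
  have -> : W.[u] = (\prod_(z <- xs) (u - z)) ^+ 2 * ((-1) ^+ b * (1 - u) ^+ b).
    by rewrite -exprMn mulN1r opprB.
  by rewrite [X in c * X]mulrCA !mulrA.
by rewrite nmulr_rle0// mulr_ge0 ?sqr_ge0// exprn_ge0// subr_ge0.
Qed.

(* With p = X q, the inequality p <= eta on ]0, 1] is ln + q <= 0. *)
Lemma hermite_eta_le (R : realType) (t : nat) (t_gt0 : (0 < t)%N)
    (x : 'I_(t %/ 2) -> R) (a : nat -> R) :
  let p : {poly R} := \sum_(1 <= k < t.+1) a k *: 'X^k in
  (forall i, 0 < x i < 1) ->
  (forall i j : 'I_(t %/ 2), (i < j)%N -> x i < x j) ->
  (odd t -> p.[1] = 0) ->
  (forall (i : 'I_(t %/ 2)) (j : nat), (j <= 1)%N ->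
     (p^`(j)).[x i] = derive1n j (@eta_fn R) (x i)) ->
  forall u, 0 <= u <= 1 -> p.[u] <= eta_fn u.
Proof.
move=> p x01 xlt p1 px u /andP[].
rewrite le_eqVlt => /predU1P[<- _|u0 u1].
  rewrite /eta_fn oppr0 mul0r /p horner_sum big_nat big1// => k /andP[k0 _].
  by rewrite hornerZ hornerXn expr0n gtn_eqF// mulr0.
pose q : {poly R} := \sum_(1 <= k < t.+1) a k *: 'X^(k.-1).
have pE : p = 'X * q.
  rewrite /p /q mulr_sumr; apply: eq_big_nat => k /andP[k0 _].
  by rewrite -scalerAr -exprS prednK.
have sq : (size q <= t)%N.
  rewrite /q big_nat; apply: (leq_trans (size_sum _ _ _)).
  apply/bigmax_leqP_seq => k _ /andP[k0 kt].
  by rewrite (leq_trans (size_scale_leq _ _))// size_polyXn prednK.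
pose xs := [seq x i | i : 'I_(t %/ 2)].
have tE : (size xs + size xs + odd t)%N = t.
  by rewrite size_map -cardT card_ord addnn divn2 addnC odd_double_half.
have xsP z : z \in xs -> exists i, z = x i by move=> /mapP[i _ ->]; exists i.
have deta (z : R) : 0 < z -> (@eta_fn R)^`()%classic z = - ln z - 1.
  move=> z0; rewrite derive1E.
  have : is_derive z 1 (@eta_fn R) (- z * z^-1 + ln z * (- 1)).
    apply: is_deriveM; exact: is_derive1_ln.
  move=> /(@derive_val _ _ _ _ _ _ _) ->.
  by rewrite mulNr divff ?gt_eqF// mulrN1 addrC.
suff : ln u + q.[u] <= 0.
  move=> h; rewrite pE hornerM hornerX /eta_fn mulNr -mulrN.
  by rewrite ler_wpM2l ?(ltW u0)//; lra.
apply: (@ln_hermite_le R (odd t) xs); rewrite ?tE ?u0//.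
- rewrite map_inj_uniq ?enum_uniq// => i j xij; apply/val_inj => /=.
  by case: (ltngtP i j) => // /xlt; rewrite xij ltxx.
- by move=> z /xsP[i ->].
- move=> z /xsP[i ->]; have /andP[xi0 xi1] := x01 i.
  have q0 : q.[x i] = - ln (x i).
    have := px i 0%N isT; rewrite derivn0 derive1n0 pE hornerM hornerX /eta_fn.
    by rewrite mulNr -mulrN; apply/mulfI; rewrite gt_eqF.
  (* [p' = q + X q'] and [q(x_i) = - ln x_i], so matching [- ln x_i - 1] says exactly
     [1 + x_i q'(x_i) = 0]. *)
  have := px i 1%N isT; rewrite derivn1 derive1n1 deta// pE derivM derivX.
  rewrite rootE !(hornerD, hornerM, hornerX, hornerC) q0 => h.
  by split; [rewrite subrr | apply/eqP; lra].
- by move=> /p1; rewrite pE hornerM hornerX mul1r.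
Qed.

(** * Positive semidefinite matrices *)

Lemma complex_ReD (R : realType) (x y : R[i]) :
  complex.Re (x + y) = complex.Re x + complex.Re y.
Proof. by case: x y => ? ? []. Qed.

Lemma complex_ReN (R : realType) (x : R[i]) : complex.Re (- x) = - complex.Re x.
Proof. by case: x. Qed.

Lemma complex_ReM (R : realType) (x y : R[i]) : complex.Re (x * y) =
  complex.Re x * complex.Re y - complex.Im x * complex.Im y.
Proof. by case: x y => ? ? []. Qed.

Lemma complex_Re_realM (R : realType) (x : R) (y : R[i]) :
  complex.Re (x%:C * y) = x * complex.Re y.
Proof. by rewrite complex_ReM /= mul0r subr0. Qed.

Lemma complex_Re_sum (R : realType) (I : Type) (s : seq I) (P : pred I)
    (F : I -> R[i]) :
  complex.Re (\sum_(i <- s | P i) F i) = \sum_(i <- s | P i) complex.Re (F i).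
Proof. exact: (big_morph (@complex.Re R) (@complex_ReD R)). Qed.

Lemma ge0_ReK (R : realType) (x : R[i]) : 0 <= x -> (complex.Re x)%:C = x.
Proof. by case: x => a b; rewrite lecE/= => /andP[/eqP-> _]. Qed.

Lemma ge0_Re (R : realType) (x : R[i]) : 0 <= x -> 0 <= complex.Re x.
Proof. by rewrite lecE => /andP[]. Qed.

Definition expval (R : realType) (d : nat) (A : 'M[R[i]]_d) (v : 'cV[R[i]]_d)
    : R :=
  complex.Re ((v^t* *m A *m v) 0 0).

Lemma psd_expval (R : realType) (d : nat) (A : 'M[R[i]]_d) v :
  psd A -> (v^t* *m A *m v) 0 0 = (expval A v)%:C.
Proof. by move=> [_ /(_ v) A0]; rewrite /expval ge0_ReK. Qed.

Lemma psd_expval_ge0 (R : realType) (d : nat) (A : 'M[R[i]]_d) v :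
  psd A -> 0 <= expval A v.
Proof. by move=> [_ /(_ v) A0]; exact: ge0_Re. Qed.

(** The eigenvalues are found as expectations of [A] in its eigenvectors, hence real and
    nonnegative. The same [e] resolves the identity, so [Tr[A B]] and [Tr[B]] both expand in the
    numbers [expval B (e j)]. *)
Lemma psd_spectral (R : realType) (d : nat) (A : 'M[R[i]]_d) : psd A ->
  exists (s : 'I_d -> R) (e : 'I_d -> 'cV[R[i]]_d),
    [/\ forall j, 0 <= s j,
        A = \sum_j (s j)%:C *: (e j *m (e j)^t*),
        1%:M = \sum_j e j *m (e j)^t* &
        forall j, (e j)^t* *m e j = 1%:M].
Proof.
move=> psdA; have [hA A0] := psdA.
have /orthomx_spectralP AE := hermitian_normalmx hA.
set P := spectralmx A in AE; set sp := spectral_diag A in AE.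
have uP : P \is unitarymx by exact: spectral_unitarymx.
rewrite invmx_unitary// in AE.
have uPt : P^t* \is unitarymx by rewrite trmxC_unitary.
have PPt : P *m P^t* = 1%:M by exact/unitarymxP.
pose e j := col j (P^t*).
have eC j : (e j)^t* = row j P.
  by apply/matrixP => i k; rewrite !mxE conjCK.
have ee j : (e j)^t* *m e j = 1%:M.
  rewrite eC rowE /e colE !mulmxA -(mulmxA _ P) PPt mulmx1 mul_delta_mx.
  by apply/matrixP => i k; rewrite !mxE !ord1.
have sumE (D : 'rV[R[i]]_d) :
    P^t* *m diag_mx D *m P = \sum_j D 0 j *: (e j *m (e j)^t*).
  apply/matrixP => i k; rewrite !mxE summxE; apply: eq_bigr => j _.
  by rewrite mul_mx_diag eC !mxE big_ord1 !mxE; ring.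
have spE j : sp 0 j = (expval A (e j))%:C.
  rewrite -psd_expval// AE eC rowE /e colE !mulmxA -(mulmxA _ P) PPt mulmx1.
  by rewrite -(mulmxA _ P) PPt mulmx1 -rowE -colE !mxE eqxx mulr1n.
exists (fun j => expval A (e j)), e; split => //.
- by move=> j; exact: psd_expval_ge0.
- by rewrite {1}AE sumE; apply: eq_bigr => j _; rewrite spE.
- transitivity (P^t* *m diag_mx (const_mx 1) *m P).
    rewrite diag_const_mx mulmx1.
    by have /unitarymxP := uPt; rewrite trmxCK => ->.
  by rewrite sumE; apply: eq_bigr => j _; rewrite mxE scale1r.
Qed.

Lemma psd_mxtraceM (R : realType) (d : nat) (s : 'I_d -> R)
    (e : 'I_d -> 'cV[R[i]]_d) (B : 'M[R[i]]_d) :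
  complex.Re (\tr ((\sum_j (s j)%:C *: (e j *m (e j)^t*)) *m B)) =
  \sum_j s j * expval B (e j).
Proof.
rewrite mulmx_suml [mxtrace _]linear_sum complex_Re_sum; apply: eq_bigr => j _.
rewrite -scalemxAl linearZ /= -mulmxA mxtrace_mulC trace_mx11.
exact: complex_Re_realM.
Qed.

Lemma psd_trace_ge0 (R : realType) (d : nat) (A B : 'M[R[i]]_d) :
  psd A -> psd B -> 0 <= complex.Re (\tr (A *m B)).
Proof.
move=> /psd_spectral[s [e [s0 -> _ _]]] pB.
rewrite psd_mxtraceM sumr_ge0// => j _.
by rewrite mulr_ge0//; exact: psd_expval_ge0.
Qed.

Lemma effect_trace_le (R : realType) (d : nat) (A B : 'M[R[i]]_d) :
  psd A -> psd (1%:M - B) ->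
  complex.Re (\tr (A *m B)) <= complex.Re (\tr A).
Proof.
move=> pA pB; have := psd_trace_ge0 pA pB.
rewrite mulmxBr mulmx1 [mxtrace _]linearB /= complex_ReD complex_ReN.
by rewrite subr_ge0.
Qed.

Lemma psd_mxtrace (R : realType) (d : nat) (A : 'M[R[i]]_d) :
  psd A -> (complex.Re (\tr A))%:C = \tr A.
Proof.
move=> /psd_spectral[s [e [s0 AE _ e1]]].
suff -> : \tr A = (\sum_j s j)%:C by [].
rewrite AE [mxtrace _]linear_sum rmorph_sum; apply: eq_bigr => j _ /=.
by rewrite linearZ /= mxtrace_mulC e1 mxtrace1 mulr1.
Qed.

Lemma psd_rank1 (R : realType) (d : nat) (v : 'cV[R[i]]_d) :
  psd (v *m v^t*).
Proof.
have vC : (v *m v^t*)^t* = v *m v^t*.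
  by rewrite trmx_mul map_mxM trmxCK.
split.
  by apply/is_hermitianmxP; rewrite expr0 scale1r vC.
move=> w; rewrite mulmxA -mulmxA.
have -> : w^t* *m v = (v^t* *m w)^t* by rewrite trmx_mul map_mxM trmxCK.
by rewrite mxE big_ord1 !mxE mulrC mul_conjC_ge0.
Qed.

(** In the eigenbasis of [A] the two sides are the sums of [s_j |<e_j, v>|^2] and of [s_j]; each
    weight is at most one by Parseval, which is [H]. *)
Lemma expval_le_trace (R : realType) (d : nat) (A : 'M[R[i]]_d) v :
  psd A -> v^t* *m v = 1%:M -> expval A v <= complex.Re (\tr A).
Proof.
move=> /psd_spectral[s [e [s0 AE e1 ee]]] v1.
have vv : \tr (v *m v^t*) = 1 by rewrite mxtrace_mulC v1 mxtrace1.
have evE B : expval B v = complex.Re (\tr (B *m (v *m v^t*))).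
  by rewrite mulmxA mxtrace_mulC trace_mx11 mulmxA.
have pvv : psd (v *m v^t*).
  exact: psd_rank1.
have H j : expval (v *m v^t*) (e j) <= 1.
  have := psd_mxtraceM (fun => 1) e (v *m v^t*).
  under eq_bigr do rewrite scale1r.
  rewrite -e1 mul1mx vv => /= ->; rewrite (bigD1 j)//= mul1r lerDl sumr_ge0//.
  by move=> i _; rewrite mul1r; exact: psd_expval_ge0.
rewrite evE AE psd_mxtraceM -[in leRHS](mulmx1 (\sum__ _)) psd_mxtraceM.
apply: ler_sum => j _; rewrite ler_wpM2l// (le_trans (H j))//.
by rewrite /expval mulmx1 ee mxE.
Qed.

(** * Moments of a design *)

Definition tens_vec (R : realType) (d k : nat) (v : 'cV[R[i]]_d)
    : 'cV[R[i]]_(tens_dim d k) :=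
  \col_i \prod_(l < k) v (tens_index i l) 0.

Lemma sum_tens_index (V : nmodType) (d k : nat) (F : {ffun 'I_k -> 'I_d} -> V) :
  \sum_(i < tens_dim d k) F (tens_index i) = \sum_f F f.
Proof. by rewrite -big_enum_val. Qed.

Lemma tens_vecC (R : realType) (d k : nat) (v : 'cV[R[i]]_d) i :
  ((tens_vec k v)^t*) 0 i = \prod_(l < k) (v^t*) 0 (tens_index i l).
Proof. by rewrite !mxE rmorph_prod; apply: eq_bigr => l _; rewrite !mxE. Qed.

(** The [k]-th power of a sum over ['I_d] expands into a sum over maps ['I_k -> 'I_d], that is, over
    the basis of the tensor power. The next lemma expands twice, over columns and over rows. *)
Lemma tens_vec_norm (R : realType) (d k : nat) (v : 'cV[R[i]]_d) :
  ((tens_vec k v)^t* *m tens_vec k v) 0 0 = ((v^t* *m v) 0 0) ^+ k.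
Proof.
rewrite [in RHS]mxE -[k in RHS]card_ord -prodr_const bigA_distr_bigA /=.
rewrite mxE -sum_tens_index; apply: eq_bigr => i _.
by rewrite tens_vecC mxE -big_split.
Qed.

Lemma tens_power_expval (R : realType) (d k : nat) (A : 'M[R[i]]_d)
    (v : 'cV[R[i]]_d) :
  ((tens_vec k v)^t* *m tens_power k A *m tens_vec k v) 0 0 =
  ((v^t* *m A *m v) 0 0) ^+ k.
Proof.
rewrite [in RHS]mxE -[k in RHS]card_ord -prodr_const bigA_distr_bigA /=.
rewrite mxE -sum_tens_index; apply: eq_bigr => j _.
rewrite [tens_vec k v j 0]mxE big_split /=; congr (_ * _).
under [RHS]eq_bigr do rewrite mxE; rewrite bigA_distr_bigA /=.
rewrite mxE -sum_tens_index; apply: eq_bigr => i _.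
by rewrite tens_vecC mxE big_split.
Qed.

(** Permuting tensor factors only reorders the scalars in each coordinate, so the vector lies in
    [sym_space]. This makes the right-hand side of the design condition the same number for every
    unit [v]. *)
Lemma tens_vec_sym (R : realType) (d k : nat) (v : 'cV[R[i]]_d) :
  (tens_vec k v)^t* *m sym_proj R d k = (tens_vec k v)^t*.
Proof.
apply: proj_ortho_id; apply/sub_bigcapmxP => s _; apply/sub_kermxP.
rewrite mulmxBr mulmx1; apply/eqP; rewrite subr_eq0; apply/eqP.
apply/rowP => j; rewrite mxE.
(* The only row with a nonzero entry in column [j] of the permutation matrix: [j] precomposed with
   the inverse of [s]. *)
pose i0 : 'I_(tens_dim d k) :=
  enum_rank [ffun l => tens_index j (s^-1%g l)].
have i0E : tens_index i0 = [ffun l => tens_index j (s^-1%g l)].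
  exact: enum_rankK.
rewrite (bigD1 i0)//= big1 ?addr0 => [|i ii0]; last first.
  rewrite [tens_perm _ _ _ _ _]mxE; case: eqP => [jE|]; last by rewrite mulr0.
  case/eqP: ii0; apply: enum_val_inj.
  rewrite -/(tens_index i) -/(tens_index i0).
  by rewrite i0E; apply/ffunP => l; rewrite ffunE jE ffunE permKV.
rewrite [tens_perm _ _ _ _ _]mxE i0E.
have -> : tens_index j ==
    [ffun l => [ffun l0 => tens_index j (s^-1%g l0)] (s l)].
  by apply/eqP/ffunP => l; rewrite !ffunE permK.
rewrite mulr1 !tens_vecC i0E (reindex_inj (@perm_inj _ s)) /=.
by apply: eq_bigr => l _; rewrite ffunE permK.
Qed.

(** This turns entrywise matrix integrals into scalar ones: the real part of the form is a fixed
    real combination of real and imaginary parts of entries. *)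
Lemma mx_integral_form (R : realType) (n : nat) (F : R -> 'M[R[i]]_n)
    (v : 'rV[R[i]]_n) (w : 'cV[R[i]]_n) : mx_integrable F ->
  (@lebesgue_measure R).-integrable setT
     (fun y => (complex.Re ((v *m F y *m w) 0 0))%:E) /\
  (\int[@lebesgue_measure R]_y (complex.Re ((v *m F y *m w) 0 0))%:E)%E =
  (complex.Re ((v *m mx_integral F *m w) 0 0))%:E.
Proof.
move=> iF.
pose c i j : R[i] := v 0 i * w j 0.
have formE (M : 'M[R[i]]_n) : complex.Re ((v *m M *m w) 0 0) =
   \sum_j \sum_i (complex.Re (c i j) * complex.Re (M i j) -
                  complex.Im (c i j) * complex.Im (M i j)).
  rewrite mxE complex_Re_sum; apply: eq_bigr => j _.
  rewrite mxE mulr_suml complex_Re_sum.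
  by apply: eq_bigr => i _; rewrite -complex_ReM mulrAC.
have iRe i j : (@lebesgue_measure R).-integrable setT
    (fun y => (complex.Re (c i j) * complex.Re (F y i j))%:E).
  have -> : (fun y => (complex.Re (c i j) * complex.Re (F y i j))%:E) =
     (fun y => (complex.Re (c i j))%:E * (complex.Re (F y i j))%:E)%E.
    by [].
  by apply: integrableZl => //; have [] := iF i j.
have iIm i j : (@lebesgue_measure R).-integrable setT
    (fun y => (complex.Im (c i j) * complex.Im (F y i j))%:E).
  have -> : (fun y => (complex.Im (c i j) * complex.Im (F y i j))%:E) =
     (fun y => (complex.Im (c i j))%:E * (complex.Im (F y i j))%:E)%E.
    by [].
  by apply: integrableZl => //; have [] := iF i j.
have iB i j : (@lebesgue_measure R).-integrable setT
    (fun y => (complex.Re (c i j) * complex.Re (F y i j) -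
               complex.Im (c i j) * complex.Im (F y i j))%:E).
  by under eq_fun do rewrite EFinB; exact: integrableB.
have iS j : (@lebesgue_measure R).-integrable setT
    (fun y => (\sum_i (complex.Re (c i j) * complex.Re (F y i j) -
               complex.Im (c i j) * complex.Im (F y i j)))%:E).
  by under eq_fun do rewrite -sumEFin; exact: integrable_sum.
split; first by under eq_fun do rewrite formE -sumEFin; exact: integrable_sum.
under eq_integral do rewrite formE -sumEFin.
rewrite integral_sum// formE -sumEFin; apply: eq_bigr => j _.
under eq_integral do rewrite -sumEFin.
rewrite integral_sum// -sumEFin; apply: eq_bigr => i _.
under eq_integral do rewrite EFinB; rewrite integralB// EFinB.
have [iR iI] := iF i j.
congr (_ - _)%E.
  under eq_integral do rewrite EFinM.
  rewrite integralZl// mxE /= EFinM /Rintegral fineK//.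
  exact: integrable_fin_num.
under eq_integral do rewrite EFinM.
rewrite integralZl// mxE /= EFinM /Rintegral fineK//.
exact: integrable_fin_num.
Qed.

(** The design condition is evaluated in the state [tens_vec k v], in which [sym_proj] has
    expectation one. *)
Lemma design_moment (R : realType) (d t : nat) (E : R -> 'M[R[i]]_d)
    (k : nat) (v : 'cV[R[i]]_d) :
  (1 <= k <= t)%N -> is_design_povm t E -> v^t* *m v = 1%:M ->
  (@lebesgue_measure R).-integrable setT
     (fun y => (expval (E y) v ^+ k / complex.Re (\tr (E y)) ^+ (k - 1))%:E) /\
  (\int[@lebesgue_measure R]_y
     (expval (E y) v ^+ k / complex.Re (\tr (E y)) ^+ (k - 1))%:E)%E =
  (d%:R / 'C(d - 1 + k, k)%:R)%:E.
Proof.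
move=> kt [[mE effE _] /(_ k kt)[iF FE]] v1.
set F := fun y => _ in iF FE.
have FvE y : complex.Re (((tens_vec k v)^t* *m F y *m tens_vec k v) 0 0) =
    expval (E y) v ^+ k / complex.Re (\tr (E y)) ^+ (k - 1).
  have pE := (effE y).1.
  rewrite /F -scalemxAr -scalemxAl mxE tens_power_expval psd_expval//.
  rewrite -(psd_mxtrace pE) -!rmorphXn -fmorphV -rmorphM /=.
  by rewrite mulrC.
have [iv intv] := mx_integral_form ((tens_vec k v)^t*) (tens_vec k v) iF.
split; first by under eq_fun do rewrite -FvE.
under eq_integral do rewrite -FvE.
rewrite intv FE -scalemxAr tens_vec_sym -scalemxAl mxE tens_vec_norm v1 mxE.
by rewrite eqxx expr1n mulr1 -!(rmorph_nat (real_complex R)) -fmorphV -rmorphM.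
Qed.

(** * The entropy of the outcome distribution of a state *)

Lemma eta_fn_ge0 (R : realType) (u : R) : 0 <= u <= 1 -> 0 <= eta_fn u.
Proof.
by move=> /andP[u0 u1]; rewrite /eta_fn mulNr oppr_ge0 mulr_ge0_le0// ln_le0.
Qed.

Lemma ln_le_subr1 (R : realType) (u : R) : 0 < u -> ln u <= u - 1.
Proof.
move=> u0; have := @le_ln1Dx R (u - 1); rewrite addrCA subrr addr0.
by apply; lra.
Qed.

(** The right side is the tangent line of [eta_fn] at [u]; it comes from [ln (u / v) <= u / v - 1]
    times [v]. Only the point of tangency has to be positive. *)
Lemma eta_fn_tangent (R : realType) (u v : R) :
  0 < u -> 0 <= v -> eta_fn v <= u - v - v * ln u.
Proof.
move=> u0; rewrite le_eqVlt => /predU1P[<-|v0].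
  by rewrite /eta_fn !(oppr0, mul0r, addr0) ltW.
have := ln_le_subr1 (divr_gt0 u0 v0); rewrite ln_div ?posrE// => h.
have := ler_wpM2l (ltW v0) h.
rewrite mulrBr mulrBr mulr1 mulrCA divff ?gt_eqF// mulr1 /eta_fn mulNr.
lra.
Qed.

Lemma eta_fn_le1 (R : realType) (u : R) : 0 <= u -> eta_fn u <= 1.
Proof.
move=> u0; have := eta_fn_tangent (@ltr01 R) u0; rewrite ln1 mulr0 subr0; lra.
Qed.

(** Average the tangent bound at the mean [U]. If [U = 0] there is no tangent, but then every
    [l i * u i] vanishes. *)
Lemma eta_fn_jensen (R : realType) (I : finType) (l u : I -> R) :
  (forall i, 0 <= l i) -> \sum_i l i = 1 -> (forall i, 0 <= u i) ->
  \sum_i l i * eta_fn (u i) <= eta_fn (\sum_i l i * u i).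
Proof.
move=> l0 l1 u0; set U := \sum_i l i * u i.
have lu0 i : 0 <= l i * u i by rewrite mulr_ge0.
have : 0 <= U by rewrite sumr_ge0.
rewrite le_eqVlt => /predU1P[U0|U0].
  have lui i : l i * u i = 0.
    have /eqP := esym U0; rewrite psumr_eq0// => /allP/(_ i).
    by rewrite mem_index_enum => /(_ isT)/eqP.
  rewrite -U0 /eta_fn oppr0 mul0r big1// => i _.
  by rewrite mulrA mulrN lui oppr0 mul0r.
have -> : eta_fn U = \sum_i l i * (U - u i - u i * ln U).
  under eq_bigr do rewrite !mulrBr mulrA.
  rewrite !sumrB -!mulr_suml l1 mul1r -/U subrr sub0r -mulNr.
  by [].
by apply: ler_sum => i _; rewrite ler_wpM2l// eta_fn_tangent.
Qed.

Lemma measurable_funV (R : realType) (dd : measure_display)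
    (Z : measurableType dd) (f : Z -> R) :
  measurable_fun setT f -> measurable_fun setT (fun z => (f z)^-1).
Proof.
move=> mf.
(* Real powers invert nonnegative arguments only, hence the square; at zeros of [f] both sides are
   [0]. *)
have -> : (fun z => (f z)^-1) = (fun z => f z * (f z ^+ 2) `^ (- 1)).
  apply/funext => z; rewrite powR_inv1 ?sqr_ge0// expr2 invfM.
  have [->|f0] := eqVneq (f z) 0; first by rewrite invr0 mul0r.
  by rewrite mulrA divff// mul1r.
apply: measurable_funM => //.
by apply: (measurableT_comp (measurable_powR _)); exact: measurable_funX.
Qed.

Lemma measurable_eta_fn (R : realType) : measurable_fun setT (@eta_fn R).
Proof.
by apply: measurable_funM; [exact: oppr_measurable|exact: measurable_ln].
Qed.

Lemma measurable_Re_mxtraceM (R : realType) (d : nat) (dd : measure_display)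
    (Z : measurableType dd) (F G : Z -> 'M[R[i]]_d) :
  (forall i j, measurable_fun setT (fun z => complex.Re (F z i j)) /\
               measurable_fun setT (fun z => complex.Im (F z i j))) ->
  (forall i j, measurable_fun setT (fun z => complex.Re (G z i j)) /\
               measurable_fun setT (fun z => complex.Im (G z i j))) ->
  measurable_fun setT (fun z => complex.Re (\tr (F z *m G z))).
Proof.
move=> mF mG.
have -> : (fun z => complex.Re (\tr (F z *m G z))) = fun z => \sum_i \sum_j
    (complex.Re (F z i j) * complex.Re (G z j i) -
     complex.Im (F z i j) * complex.Im (G z j i)).
  apply/funext => z; rewrite complex_Re_sum; apply: eq_bigr => i _.
  by rewrite mxE complex_Re_sum; apply: eq_bigr => j _; rewrite complex_ReM.
apply: measurable_sum => i; apply: measurable_sum => j.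
have [? ?] := mF i j; have [? ?] := mG j i.
by apply: measurable_funB; exact: measurable_funM.
Qed.

Definition born (R : realType) (d : nat) (rho E : 'M[R[i]]_d) : R :=
  complex.Re (\tr (rho *m E)) / (complex.Re (\tr rho) * complex.Re (\tr E)).

Lemma mxtrace_ge0 (R : realType) (d : nat) (A : 'M[R[i]]_d) :
  psd A -> 0 <= complex.Re (\tr A).
Proof.
move=> /psd_spectral[s [e [s0 -> _ e1]]]; rewrite -[X in \tr X]mulmx1.
by rewrite psd_mxtraceM sumr_ge0// => j _; rewrite /expval mulmx1 e1 mxE mulr1.
Qed.

(** The weights are the eigenvalues divided by the trace. They are chosen before [B], so one
    decomposition serves all outcomes of the POVM. *)
Lemma expval_jensen (R : realType) (d : nat) (rho : 'M[R[i]]_d) :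
  psd rho -> 0 < complex.Re (\tr rho) ->
  exists (l : 'I_d -> R) (e : 'I_d -> 'cV[R[i]]_d),
    [/\ forall j, 0 <= l j, \sum_j l j = 1,
        forall j, (e j)^t* *m e j = 1%:M &
        forall B, complex.Re (\tr (rho *m B)) / complex.Re (\tr rho) =
                  \sum_j l j * expval B (e j)].
Proof.
move=> /psd_spectral[s [e [s0 rhoE _ e1]]] r0; set r := complex.Re (\tr rho).
have rE : r = \sum_j s j.
  rewrite /r -[rho]mulmx1 {1}rhoE psd_mxtraceM; apply: eq_bigr => j _.
  by rewrite /expval mulmx1 e1 mxE mulr1.
exists (fun j => s j / r), e; split => // [j||B].
- by rewrite divr_ge0// ltW.
- by rewrite -mulr_suml -rE divff// gt_eqF.
- rewrite {1}rhoE psd_mxtraceM mulr_suml; apply: eq_bigr => j _.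
  by rewrite mulrAC.
Qed.

Lemma psd_trace_leM (R : realType) (d : nat) (A B : 'M[R[i]]_d) :
  psd A -> psd B ->
  complex.Re (\tr (A *m B)) <= complex.Re (\tr A) * complex.Re (\tr B).
Proof.
move=> /psd_spectral[s [e [s0 AE _ e1]]] pB.
have -> : complex.Re (\tr A) = \sum_j s j.
  rewrite -[A]mulmx1 AE psd_mxtraceM; apply: eq_bigr => j _.
  by rewrite /expval mulmx1 e1 mxE mulr1.
rewrite AE psd_mxtraceM mulr_suml; apply: ler_sum => j _.
by rewrite ler_wpM2l// expval_le_trace.
Qed.

Lemma born_itv (R : realType) (d : nat) (rho E : 'M[R[i]]_d) :
  psd rho -> psd E -> 0 <= born rho E <= 1.
Proof.
move=> prho pE; rewrite /born.
have := mulr_ge0 (mxtrace_ge0 prho) (mxtrace_ge0 pE).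
rewrite le_eqVlt => /predU1P[<-|PT0]; first by rewrite invr0 mulr0 lexx ler01.
rewrite divr_ge0 ?psd_trace_ge0 ?(ltW PT0)//= ler_pdivrMr// mul1r.
exact: psd_trace_leM.
Qed.

(* For pure states the design condition computes the integral of each monomial
   of p; concavity of eta reduces a mixed state to its eigenvectors. *)
Lemma design_eta_integral (R : realType) (d t : nat) (E : R -> 'M[R[i]]_d)
    (a : nat -> R) (rho : 'M[R[i]]_d) :
  is_design_povm t E ->
  (forall u : R, 0 <= u <= 1 ->
     (\sum_(1 <= k < t.+1) a k *: 'X^k).[u] <= eta_fn u) ->
  psd rho -> 0 < complex.Re (\tr rho) ->
  (@lebesgue_measure R).-integrable setT
    (fun y => (complex.Re (\tr (E y)))%:E) ->
  measurable_fun setT (fun y : measurableTypeR R => born rho (E y)) ->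
  ((\sum_(1 <= k < t.+1) a k * (d%:R / 'C(d - 1 + k, k)%:R))%:E <=
   \int[@lebesgue_measure R]_y
     (complex.Re (\tr (E y)) * eta_fn (born rho (E y)))%:E)%E.
Proof.
move=> desE p_le prho r0 iT mU.
have effE y : psd (E y) by have [[_ /(_ y)[]]] := desE.
have [l [e [l0 l1 e1 avg]]] := expval_jensen prho r0.
pose T y := complex.Re (\tr (E y)).
have T_ge0 y : 0 <= T y by exact: mxtrace_ge0.
(* The index [k] stands for the moment of order [k.+1], so the trace carries the exponent [k]. *)
pose m (j : 'I_d) (k : 'I_t) y := expval (E y) (e j) ^+ k.+1 / T y ^+ k.
have im j k : (@lebesgue_measure R).-integrable setT (fun y => (m j k y)%:E) /\
   (\int[@lebesgue_measure R]_y (m j k y)%:E)%E =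
     (d%:R / 'C(d - 1 + k.+1, k.+1)%:R)%:E.
  have := @design_moment R d t E k.+1 (e j) (ltn_ord k) desE (e1 j).
  by rewrite subn1.
pose h j (k : 'I_t) y := ((l j * a k.+1)%:E * (m j k y)%:E)%E.
have ih j k : (@lebesgue_measure R).-integrable setT (h j k).
  by apply: integrableZl => //; exact: (im j k).1.
have ihs j : (@lebesgue_measure R).-integrable setT
    (fun y => (\sum_(k < t) h j k y)%E) by exact: integrable_sum.
(* A moment has the same integral for every eigenvector, so averaging with the weights [l] leaves
   the sum unchanged. *)
have -> : (\sum_(1 <= k < t.+1) a k * (d%:R / 'C(d - 1 + k, k)%:R))%:E =
    (\int[@lebesgue_measure R]_y (\sum_j \sum_(k < t) h j k y))%E.
  rewrite (integral_sum _ ihs)//.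
  have intj j : (\int[@lebesgue_measure R]_y (\sum_(k < t) h j k y) =
     (l j * \sum_(1 <= k < t.+1) a k * (d%:R / 'C(d - 1 + k, k)%:R))%:E)%E.
    rewrite (integral_sum _ (ih j))// big_add1 big_mkord /= mulr_sumr -sumEFin.
    apply: eq_bigr => k _; rewrite /h integralZl//; last exact: (im j k).1.
    by rewrite (im j k).2 -EFinM mulrA.
  rewrite (eq_bigr _ (fun j _ => intj j)).
  by rewrite sumEFin -mulr_suml l1 mul1r.
apply: le_integral => //.
- exact: integrable_sum.
- apply: (le_integrable _ _ _ iT) => //.
    apply/measurable_EFinP; apply: measurable_funM.
      by apply/measurable_EFinP; exact: measurable_int iT.
    exact: measurableT_comp (@measurable_eta_fn R) mU.
  move=> y _; have /andP[U0 U1] := born_itv prho (effE y).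
  rewrite !abse_EFin lee_fin normrM ler_piMr// ger0_norm ?eta_fn_le1//.
  by rewrite eta_fn_ge0// U0.
move=> y _.
have hE : (\sum_j \sum_(k < t) h j k y)%E =
    (\sum_j l j * \sum_(k < t) a k.+1 * m j k y)%:E.
  rewrite -sumEFin; apply: eq_bigr => j _; rewrite mulr_sumr -sumEFin.
  by apply: eq_bigr => k _; rewrite mulrA.
rewrite hE lee_fin -/(T y).
have [Ty|Ty] := eqVneq (T y) 0.
  rewrite Ty mul0r big1// => j _; rewrite big1 ?mulr0// => k _.
  suff -> : m j k y = 0 by rewrite mulr0.
  have ev0 : expval (E y) (e j) = 0.
    apply: le_anti; rewrite psd_expval_ge0// andbT -Ty.
    exact: expval_le_trace.
  by rewrite /m ev0 expr0n mul0r.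
have Ty0 : 0 < T y by rewrite lt_def Ty T_ge0.
pose u j := expval (E y) (e j) / T y.
have u01 j : 0 <= u j <= 1.
  rewrite divr_ge0 ?psd_expval_ge0//= ler_pdivrMr// mul1r.
  exact: expval_le_trace.
have -> : born rho (E y) = \sum_j l j * u j.
  rewrite /born invfM mulrA avg mulr_suml; apply: eq_bigr => j _.
  by rewrite mulrA.
(* The normalisation in the design condition leaves one factor [T y] at every order, so the moments
   assemble into [T y] times the polynomial at [u j]. *)
have mE j (k : 'I_t) : m j k y = T y * u j ^+ k.+1.
  by rewrite /m /u expr_div_n [T y ^+ _.+1]exprS invfM mulrCA mulVKf.
have -> : \sum_j l j * (\sum_(k < t) a k.+1 * m j k y) =
   T y * \sum_j l j * (\sum_(1 <= k < t.+1) a k *: 'X^k).[u j].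
  rewrite mulr_sumr; apply: eq_bigr => j _; rewrite mulrCA; congr (_ * _).
  rewrite horner_sum big_add1 big_mkord mulr_sumr; apply: eq_bigr => k _ /=.
  by rewrite hornerZ hornerXn mE mulrCA.
rewrite ler_wpM2l//; apply: le_trans (eta_fn_jensen l0 l1 _); last first.
  by move=> j; have /andP[] := u01 j.
by apply: ler_sum => j _; rewrite ler_wpM2l// p_le.
Qed.

(** * Mutual information *)

Lemma ge0_fin_integrable (R : realType) (dd : measure_display)
    (Z : measurableType dd) (mu : {measure set Z -> \bar R}) (f : Z -> R) :
  measurable_fun setT f -> (forall z, 0 <= f z) ->
  (\int[mu]_z (f z)%:E < +oo)%E ->
  mu.-integrable setT (fun z => (f z)%:E).
Proof.
move=> mf f0 foo; apply/integrableP; split; first exact/measurable_EFinP.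
by under eq_integral do rewrite abse_EFin ger0_norm//.
Qed.

Lemma ge0_integralZ (R : realType) (dd : measure_display)
    (Z : measurableType dd) (mu : {measure set Z -> \bar R}) (k : R)
    (f : Z -> R) :
  0 <= k -> measurable_fun setT f -> (forall z, 0 <= f z) ->
  (\int[mu]_z (k * f z)%:E = k%:E * \int[mu]_z (f z)%:E)%E.
Proof.
move=> k0 mf f0; under eq_integral do rewrite EFinM.
rewrite ge0_integralZl//; first exact/measurable_EFinP.
by move=> z _; rewrite lee_fin.
Qed.

(** Positive and negative parts are compared separately, because integrability of the mutual
    information integrand is not known in advance. *)
Lemma ae_le_integral (R : realType) (dd : measure_display)
    (Z : measurableType dd) (mu : {measure set Z -> \bar R})
    (f g : Z -> \bar R) :
  measurable_fun setT f -> measurable_fun setT g ->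
  {ae mu, forall z, f z <= g z}%E ->
  (\int[mu]_z f z <= \int[mu]_z g z)%E.
Proof.
move=> mf mg fg; rewrite integralE [leRHS]integralE leeB//.
- apply: ae_ge0_le_integral => //; [exact: measurable_funepos..|].
  apply: filterS fg => z fgz _; rewrite !funeposE.
  by rewrite ge_max !le_max fgz lexx orbT.
- apply: ae_ge0_le_integral => //; [exact: measurable_funeneg..|].
  apply: filterS fg => z fgz _; rewrite !funenegE.
  by rewrite ge_max !le_max leeN2 fgz lexx orbT.
Qed.

(* ln u <= u - 1 compares the output density Q with T / c; it is applied to
   T / (c Q), and the exceptional set where Q = 0 but J > 0 is negligible. *)
Lemma mutual_information_le (R : realType) (d1 d2 : measure_display)
    (X : measurableType d1) (Y : measurableType d2)
    (m1 : {sigma_finite_measure set X -> \bar R})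
    (m2 : {sigma_finite_measure set Y -> \bar R})
    (P : X -> R) (T Q : Y -> R) (J : X * Y -> R) (c : R) :
  0 < c -> measurable_fun setT P -> measurable_fun setT T ->
  measurable_fun setT J ->
  (forall x, 0 <= P x) -> (forall y, 0 <= T y) -> (forall y, 0 <= Q y) ->
  (forall z, 0 <= J z <= P z.1 * T z.2) ->
  (\int[m1]_x (P x)%:E = 1)%E -> (\int[m2]_y (T y)%:E = c%:E)%E ->
  (forall x, \int[m2]_y (J (x, y))%:E = (P x)%:E)%E ->
  (forall y, \int[m1]_x (J (x, y))%:E = (Q y)%:E)%E ->
  (\int[m1 \x m2]_z (J z * ln (J z / (P z.1 * Q z.2)))%:E <=
   (ln c)%:E - \int[m1 \x m2]_z
      (P z.1 * T z.2 * eta_fn (J z / (P z.1 * T z.2)))%:E)%E.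
Proof.
move=> c0 mP mT mJ P0 T0 Q0 JPT intP intT intJ2 intJ1.
have J0 z : 0 <= J z by have /andP[] := JPT z.
have mJE : measurable_fun setT (EFin \o J) by exact/measurable_EFinP.
have J0E z : (0 <= (EFin \o J) z)%E by rewrite lee_fin.
have mQ : measurable_fun setT Q.
  have := measurable_fun_fubini_tonelli_G (m1 := m1) _ mJE J0E.
  by rewrite /fubini_G /=; under eq_fun do rewrite intJ1; move/measurable_EFinP.
have mP1 : measurable_fun setT (fun z : X * Y => P z.1).
  exact: measurableT_comp mP measurable_fst.
have mT2 : measurable_fun setT (fun z : X * Y => T z.2).
  exact: measurableT_comp mT measurable_snd.
have mQ2 : measurable_fun setT (fun z : X * Y => Q z.2).
  exact: measurableT_comp mQ measurable_snd.
have mPT : measurable_fun setT (fun z : X * Y => P z.1 * T z.2).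
  exact: measurable_funM.
pose u z := J z / (P z.1 * T z.2).
have mu : measurable_fun setT u.
  by apply: measurable_funM => //; exact: measurable_funV.
have u01 z : 0 <= u z <= 1.
  have /andP[_ JPTz] := JPT z.
  have := mulr_ge0 (P0 z.1) (T0 z.2); rewrite le_eqVlt => /predU1P[PT0|PT0].
    by rewrite /u -PT0 invr0 mulr0 lexx ler01.
  by rewrite /u divr_ge0 ?(ltW PT0)//= ler_pdivrMr// mul1r.
pose K z := P z.1 * T z.2 * eta_fn (u z).
have mK : measurable_fun setT K.
  apply: measurable_funM => //.
  exact: measurableT_comp (@measurable_eta_fn R) mu.
have intJ : (\int[m1 \x m2]_z (J z)%:E = 1)%E.
  rewrite (fubini_tonelli1 (EFin \o J))// -intP; apply: eq_integral => x _.
  exact: intJ2.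
have iJ : (m1 \x m2)%E.-integrable setT (fun z => (J z)%:E).
  by apply: ge0_fin_integrable; rewrite ?intJ ?ltry.
have iPT : (m1 \x m2)%E.-integrable setT (fun z => (P z.1 * T z.2)%:E).
  apply: ge0_fin_integrable => // [z|]; first by rewrite mulr_ge0.
  rewrite (fubini_tonelli1 (fun z => (P z.1 * T z.2)%:E)); last 2 first.
  - exact/measurable_EFinP.
  - by move=> z; rewrite lee_fin mulr_ge0.
  rewrite (eq_integral (fun x => (c * P x)%:E)) => [|x _]; last first.
    by rewrite /fubini_F /= ge0_integralZ// intT -EFinM mulrC.
  by rewrite ge0_integralZ ?(ltW c0)// intP mule1 ltry.
have iK : (m1 \x m2)%E.-integrable setT (fun z => (K z)%:E).
  apply: (le_integrable _ _ _ iPT) => //; first exact/measurable_EFinP.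
  move=> z _; rewrite !abse_EFin lee_fin normrM ler_piMr//.
  have /andP[u0 u1] := u01 z.
  by rewrite ger0_norm ?eta_fn_le1// eta_fn_ge0// u0.
pose V z := J z * (T z.2 / (c * Q z.2)).
have V0 z : 0 <= V z by rewrite mulr_ge0// divr_ge0// mulr_ge0// ltW.
have mV : measurable_fun setT V.
  apply: measurable_funM => //; apply: measurable_funM => //.
  by apply: measurable_funV; exact: measurable_funM.
(* Integrating over [x] first turns [J] into [Q], which leaves [T / c] where [Q] is nonzero but [0]
   elsewhere: hence an inequality. *)
have intV : (\int[m1 \x m2]_z (V z)%:E <= 1)%E.
  rewrite (fubini_tonelli2 (fun z => (V z)%:E)); last 2 first.
  - exact/measurable_EFinP.
  - by move=> z; rewrite lee_fin.
  apply: (@le_trans _ _ (\int[m2]_y (c^-1 * T y)%:E)%E); last first.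
    by rewrite ge0_integralZ ?invr_ge0 ?(ltW c0)// intT -EFinM mulVf ?gt_eqF.
  apply: ge0_le_integral => //.
  - by move=> y _; apply: integral_ge0 => x _; rewrite lee_fin.
  - apply: measurable_fun_fubini_tonelli_G; first exact/measurable_EFinP.
    by move=> z; rewrite lee_fin.
  - by apply/measurable_EFinP; exact: measurable_funM.
  move=> y _; rewrite /fubini_G /V /=.
  under eq_integral do rewrite mulrC.
  rewrite ge0_integralZ ?intJ1//; first last.
  - exact: measurableT_comp mJ (pair2_measurable _).
  - by rewrite divr_ge0// mulr_ge0// ltW.
  rewrite -EFinM lee_fin; have [->|Qy] := eqVneq (Q y) 0.
    by rewrite mulr0 mulr_ge0// invr_ge0 ltW.
  by rewrite invfM mulrA divfK// mulrC.
have iV : (m1 \x m2)%E.-integrable setT (fun z => (V z)%:E).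
  by apply: ge0_fin_integrable => //; rewrite (le_lt_trans intV)// ltry.
(* The majorant: [V - J] is [J (w - 1)] for [w = T / (c Q)], the error allowed by [ln w <= w - 1],
   and its integral is nonpositive. *)
pose g z := ln c * J z - K z + (V z - J z).
have intg : (\int[m1 \x m2]_z (g z)%:E <=
    (ln c)%:E - \int[m1 \x m2]_z (K z)%:E)%E.
  under eq_integral do rewrite EFinD !EFinB EFinM.
  rewrite integralD//; last 2 first.
  - by apply: integrableB => //; exact: integrableZl.
  - exact: integrableB.
  rewrite !integralB//; last exact: integrableZl.
  by rewrite integralZl// intJ mule1 geeDl// sube_le0.
apply: le_trans intg; apply: ae_le_integral.
- apply/measurable_EFinP; apply: measurable_funM => //.
  apply: measurableT_comp (@measurable_ln R) _.
  apply: measurable_funM => //; apply: measurable_funV.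
  exact: measurable_funM.
- apply/measurable_EFinP; apply: measurable_funD; apply: measurable_funB => //.
  exact: measurable_funM.
have gP z : Q z.2 != 0 \/ J z = 0 ->
    J z * ln (J z / (P z.1 * Q z.2)) <= g z.
  move=> QJ; rewrite /g; have := J0 z; rewrite le_eqVlt => /predU1P[Jz|Jz].
    rewrite -Jz !mul0r mulr0 subr0 /V -Jz mul0r addr0 /K /u -Jz mul0r.
    by rewrite /eta_fn oppr0 mul0r mulr0 subr0.
  case: QJ => [Qz|J0z]; last by rewrite J0z ltxx in Jz.
  have PT0 : 0 < P z.1 * T z.2.
    by have /andP[_] := JPT z; exact: lt_le_trans.
  have Pz : 0 < P z.1.
    by rewrite lt_def P0 andbT; apply: contraTneq PT0 => ->; rewrite mul0r ltxx.
  have Tz : 0 < T z.2 by move: PT0; rewrite pmulr_rgt0.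
  have Qz0 : 0 < Q z.2 by rewrite lt_def Qz Q0.
  have uz : 0 < u z by rewrite divr_gt0.
  have wz : 0 < T z.2 / (c * Q z.2) by rewrite divr_gt0// mulr_gt0.
  have -> : K z = - (J z * ln (u z)).
    by rewrite /K /eta_fn mulrA mulrN mulrC /u mulrCA divff ?gt_eqF//; ring.
  (* Times [J], the logarithms of the three factors are [ln c * J], [- K] and a term at most
     [V - J]. *)
  have -> : J z / (P z.1 * Q z.2) = c * (u z * (T z.2 / (c * Q z.2))).
    by rewrite /u; field; rewrite !gt_eqF.
  have uwz := mulr_gt0 uz wz.
  rewrite (lnM c0 uwz) (lnM uz wz).
  have := ler_wpM2l (ltW Jz) (ln_le_subr1 wz); rewrite /V; lra.
(* The indicator of [Q = 0] as a field expression, hence measurable. Integrated over [x], [b J]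
   gives [b Q = 0], so [J] vanishes almost everywhere on that set. *)
pose b y := 1 - Q y / Q y.
have bE y : b y = (Q y == 0)%:R.
  rewrite /b; have [->|Qy] := eqVneq (Q y) 0; first by rewrite mul0r subr0.
  by rewrite divff// subrr.
have mb : measurable_fun setT b.
  apply: measurable_funB => //; apply: measurable_funM => //.
  exact: measurable_funV.
have mh : measurable_fun setT (fun z => (b z.2 * J z)%:E).
  apply/measurable_EFinP; apply: measurable_funM => //.
  exact: measurableT_comp mb measurable_snd.
have h0 z : 0 <= b z.2 * J z by rewrite bE mulr_ge0.
have : ae_eq (m1 \x m2)%E setT (fun z => (b z.2 * J z)%:E) (cst 0%E).
  apply/ae_eq_integral_abs => //.
  under eq_integral do rewrite abse_EFin ger0_norm//.
  rewrite (fubini_tonelli2 (fun z => (b z.2 * J z)%:E))//.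
  rewrite integral0_eq// => y _; rewrite /fubini_G /= ge0_integralZ ?bE//.
    by rewrite intJ1 -EFinM; case: eqP => [->|_]; rewrite ?mulr0 ?mul0r.
  exact: measurableT_comp mJ (pair2_measurable _).
apply: filterS => z /(_ I) [] /eqP; rewrite bE mulf_eq0 => bJ.
rewrite lee_fin; apply: gP; case/orP: bJ => [|/eqP]; last by right.
by rewrite pnatr_eq0 eqb0; left.
Qed.

Lemma povm_expval (R : realType) (d : nat) (E : R -> 'M[R[i]]_d)
    (v : 'cV[R[i]]_d) : is_povm E -> v^t* *m v = 1%:M ->
  (@lebesgue_measure R).-integrable setT (fun y => (expval (E y) v)%:E) /\
  (\int[@lebesgue_measure R]_y (expval (E y) v)%:E = 1)%E.
Proof.
move=> [_ _ [iE intE]] v1; have [iv ->] := mx_integral_form (v^t*) v iE.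
by split => //; rewrite intE mulmx1 v1 mxE.
Qed.

(** Stated for any [psd] matrix: states give the marginal [p_x], and the identity matrix gives the
    total trace [d] of the POVM. *)
Lemma povm_marginal (R : realType) (d : nat) (E : R -> 'M[R[i]]_d)
    (rho : 'M[R[i]]_d) : is_povm E -> psd rho ->
  (@lebesgue_measure R).-integrable setT
    (fun y => (complex.Re (\tr (rho *m E y)))%:E) /\
  (\int[@lebesgue_measure R]_y (complex.Re (\tr (rho *m E y)))%:E =
   (complex.Re (\tr rho))%:E)%E.
Proof.
move=> povmE /psd_spectral[s [e [s0 rhoE _ e1]]].
have JE y : (complex.Re (\tr (rho *m E y)))%:E =
    (\sum_j (s j)%:E * (expval (E y) (e j))%:E)%E.
  by rewrite rhoE psd_mxtraceM -sumEFin; apply: eq_bigr => j _; rewrite EFinM.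
have ij j : (@lebesgue_measure R).-integrable setT
    (fun y => (s j)%:E * (expval (E y) (e j))%:E)%E.
  by apply: integrableZl => //; exact: (povm_expval povmE (e1 j)).1.
split; first by under eq_fun do rewrite JE; exact: integrable_sum.
under eq_integral do rewrite JE.
rewrite (integral_sum _ ij)// -[rho in RHS]mulmx1 rhoE psd_mxtraceM -sumEFin.
apply: eq_bigr => j _.
rewrite integralZl//; last exact: (povm_expval povmE (e1 j)).1.
by rewrite (povm_expval povmE (e1 j)).2 /expval mulmx1 e1 mxE.
Qed.

Lemma psd1 (R : realType) (d : nat) : psd (1%:M : 'M[R[i]]_d).
Proof.
split; first by apply/is_hermitianmxP; rewrite expr0 scale1r trmx1 map_mx1.
move=> v; rewrite mulmx1 mxE sumr_ge0// => i _; rewrite !mxE mulrC.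
exact: mul_conjC_ge0.
Qed.

Theorem theorem3 (R : realType) (d t : nat) (d_gt0 : (0 < d)%N)
    (t_gt0 : (0 < t)%N) (E : R -> 'M[R[i]]_d)
    (x : 'I_(t %/ 2) -> R) (a : nat -> R) :
  let p : {poly R} := \sum_(1 <= k < t.+1) a k *: 'X^k in
  is_design_povm t E ->
  (forall i, 0 < x i < 1) ->
  (forall i j : 'I_(t %/ 2), (i < j)%N -> x i < x j) ->
  (odd t -> p.[1] = 0) ->
  (forall (i : 'I_(t %/ 2)) (j : nat), (j <= 1)%N ->
     (p^`(j)).[x i] = derive1n j (@eta_fn R) (x i)) ->
  (informational_power E <=
     (ln d%:R -
      d%:R * \sum_(1 <= k < t.+1) a k * ('C(d + k - 1, k)%:R)^-1)%:E)%E.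
Proof.
move=> p desE x01 xlt p1 px.
have p_le := hermite_eta_le t_gt0 x01 xlt p1 px.
apply: ge_ereal_sup => _ [rho [mrho st_rho intrho] <-].
have [povmE _] := desE; have [mE effE _] := povmE.
have prho z : psd (rho z) by have [] := st_rho z.
have pE y : psd (E y) by have [] := effE y.
set S := _ * _.
have SE : S = \sum_(1 <= k < t.+1) a k * (d%:R / 'C(d - 1 + k, k)%:R).
  rewrite /S mulr_sumr; apply: eq_bigr => k _.
  by rewrite mulrCA addnC -addnBA// addnC.
pose P z := complex.Re (\tr (rho z)).
pose T y := complex.Re (\tr (E y)).
pose J (z : measurableTypeR R * measurableTypeR R) := joint rho E z.1 z.2.
have [iT intT] : (@lebesgue_measure R).-integrable setT (fun y => (T y)%:E) /\
    (\int[@lebesgue_measure R]_y (T y)%:E = d%:R%:E)%E.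
  have := povm_marginal povmE (@psd1 R d).
  under eq_fun do rewrite mul1mx.
  by rewrite mxtrace1 -(rmorph_nat (real_complex R)).
have m1E : forall i j, measurable_fun setT
       (fun z : measurableTypeR R => complex.Re ((1%:M : 'M[R[i]]_d) i j)) /\
    measurable_fun setT
       (fun z : measurableTypeR R => complex.Im ((1%:M : 'M[R[i]]_d) i j)).
  by move=> i j; split.
have mP : measurable_fun setT (P : measurableTypeR R -> R).
  have := measurable_Re_mxtraceM mrho m1E.
  by under eq_fun do rewrite mulmx1.
have mT : measurable_fun setT (T : measurableTypeR R -> R).
  have := measurable_Re_mxtraceM m1E mE.
  by under eq_fun do rewrite mul1mx.
have mJ : measurable_fun setT J.
  apply: measurable_Re_mxtraceM => i j.
    have [mRe mIm] := mrho i j.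
    by split; [exact: measurableT_comp mRe measurable_fst|
              exact: measurableT_comp mIm measurable_fst].
  have [mRe mIm] := mE i j.
  by split; [exact: measurableT_comp mRe measurable_snd|
            exact: measurableT_comp mIm measurable_snd].
have P0 z : 0 <= P z by exact: mxtrace_ge0.
have T0 y : 0 <= T y by exact: mxtrace_ge0.
have J0 z : 0 <= J z by exact: psd_trace_ge0.
(* The bound of effects by the identity makes [J] integrable in [x], so that the real number
   [marginal_y] is the actual integral. *)
have JP z : J z <= P z.1.
  by apply: (effect_trace_le (prho z.1)); have [] := effE z.2.
have iP : (@lebesgue_measure R).-integrable setT (fun z => (P z)%:E).
  by apply: ge0_fin_integrable => //; rewrite intrho ltry.
have intJ2 z : (\int[@lebesgue_measure R]_y (J (z, y))%:E = (P z)%:E)%E.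
  exact: (povm_marginal povmE (prho z)).2.
have mxE z : marginal_x rho E z = P z.
  by rewrite /marginal_x /Rintegral intJ2.
have intJ1 y : (\int[@lebesgue_measure R]_z (J (z, y))%:E =
    (marginal_y rho E y)%:E)%E.
  rewrite /marginal_y /Rintegral fineK//; apply: integrable_fin_num => //.
  apply: (le_integrable _ _ _ iP) => //.
    apply/measurable_EFinP; exact: measurableT_comp mJ (pair2_measurable _).
  move=> z _; rewrite !abse_EFin lee_fin.
  by rewrite (ger0_norm (J0 (z, y))) (ger0_norm (P0 z)) (JP (z, y)).
have JPT z : 0 <= J z <= P z.1 * T z.2.
  by rewrite J0 psd_trace_leM.
rewrite /mutual_information.
under eq_integral do rewrite mxE.
have Q0 y : 0 <= marginal_y rho E y.
  by apply: Rintegral_ge0 => z _; exact: (J0 (z, y)).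
have d0 : 0 < d%:R :> R by rewrite ltr0n.
apply: (le_trans (mutual_information_le d0 mP mT mJ P0 T0 Q0 JPT intrho intT
  intJ2 intJ1)).
rewrite EFinB leeB//.
pose K (z : measurableTypeR R * measurableTypeR R) :=
  P z.1 * T z.2 * eta_fn (J z / (P z.1 * T z.2)).
have K0 z : (0 <= (K z)%:E)%E.
  rewrite lee_fin; apply: mulr_ge0; first exact: mulr_ge0.
  by apply: eta_fn_ge0; exact: born_itv.
have Teta0 z y : 0 <= T y * eta_fn (born (rho z) (E y)).
  by apply: mulr_ge0 => //; apply: eta_fn_ge0; exact: born_itv.
have mPT : measurable_fun setT
    (fun z : measurableTypeR R * measurableTypeR R => P z.1 * T z.2).
  apply: measurable_funM.
    exact: measurableT_comp mP measurable_fst.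
  exact: measurableT_comp mT measurable_snd.
have mU : measurable_fun setT
    (fun z : measurableTypeR R * measurableTypeR R => J z / (P z.1 * T z.2)).
  by apply: measurable_funM => //; exact: measurable_funV.
have mK : measurable_fun setT (fun z => (K z)%:E).
  apply/measurable_EFinP; apply: measurable_funM => //.
  exact: measurableT_comp (@measurable_eta_fn R) mU.
rewrite (fubini_tonelli1 (fun z => (K z)%:E))//.
(* [S] may be negative, while the comparison of integrals below wants nonnegative integrands; [0] is
   also a lower bound since [K >= 0]. *)
apply: (@le_trans _ _ (Num.max S 0)%:E); first by rewrite lee_fin le_max lexx.
have -> : ((Num.max S 0)%:E =
    \int[@lebesgue_measure R]_z (Num.max S 0 * P z)%:E)%E.
  by rewrite ge0_integralZ ?le_max ?lexx ?orbT// intrho mule1.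
apply: ge0_le_integral => //.
- by move=> z _; rewrite lee_fin mulr_ge0// le_max lexx orbT.
- by apply/measurable_EFinP; exact: measurable_funM.
- exact: measurable_fun_fubini_tonelli_F.
move=> z _; rewrite /fubini_F /K /=.
have := P0 z; rewrite le_eqVlt => /predU1P[<-|Pz].
  rewrite mulr0; apply: integral_ge0 => y _.
  by rewrite lee_fin !mul0r.
under eq_integral do rewrite -mulrA.
have mUz : measurable_fun setT
    (fun y : measurableTypeR R => born (rho z) (E y)).
  exact: measurableT_comp mU (pair1_measurable z).
rewrite ge0_integralZ//; first last.
- exact: Teta0.
- apply: measurable_funM => //.
  exact: measurableT_comp (@measurable_eta_fn R) mUz.
rewrite mulrC EFinM lee_wpmul2l ?lee_fin// EFin_max ge_max; apply/andP; split.
  rewrite SE; exact: (design_eta_integral desE p_le (prho z) Pz iT mUz).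
apply: integral_ge0 => y _; rewrite lee_fin; exact: Teta0.
Qed.
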